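(* Let $R$ be a Noetherian local ring and $J$ an ideal of $R$. Then $\dim R/(0:J^\infty)$ is the maximum number of analytically independent elements in $J$.
   Context: All rings are commutative with identity; $\dim$ denotes Krull dimension. $0:J^\infty := \bigcup_{m \ge 0} (0:J^m)$, where $0:J^m = \{r \in R \mid rJ^m = 0\}$. Nonzero, non-invertible elements $a_1,\ldots,a_s$ of the local ring $R$ are called analytically independent if every homogeneous polynomial (for the usual degree) in $R[x_1,\ldots,x_s]$ vanishing at $a_1,\ldots,a_s$ has all its coefficients in the maximal ideal of $R$. *)

(* Defs.v *)
From HB Require Import structures.
From mathcomp Require Import all_boot all_order all_algebra.
From mathcomp Require Import generic_quotient ring_quotient.
From mathcomp Require Import boolp classical_sets.
From mathcomp Require Import mpoly.

Set Implicit Arguments.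
Unset Strict Implicit.
Unset Printing Implicit Defensive.

Import Order.TTheory GRing.Theory.

Local Open Scope ring_scope.
Local Open Scope classical_set_scope.
Local Open Scope quotient_scope.

Section Ideals.
Variable A : comPzRingType.

Definition is_ideal (I : set A) : Prop :=
  [/\ I 0, forall x y, I x -> I y -> I (x + y) & forall a x, I x -> I (a * x)].

(* Unlike [idealr] of ring_quotient, the unit ideal is allowed. *)
Record ideal := Ideal { ideal_set :> set A; idealP : is_ideal ideal_set }.

Definition is_prime (P : set A) : Prop :=
  [/\ is_ideal P, ~ P 1 & forall u v, P (u * v) -> P u \/ P v].

Definition is_maximal (M : set A) : Prop :=
  [/\ is_ideal M, M != setT &
      forall I, is_ideal I -> M `<=` I -> I = M \/ I = setT].

Definition noetherian : Prop :=
  forall I : set A, is_ideal I -> exists (n : nat) (g : 'I_n -> A),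
    I = [set x | exists c : 'I_n -> A, x = \sum_(i < n) c i * g i].

Definition local_with (M : set A) : Prop :=
  is_maximal M /\ forall N, is_maximal N -> N = M.

Definition prime_chain (n : nat) (P : 'I_n.+1 -> set A) : Prop :=
  (forall i, is_prime (P i)) /\
  (forall i j : 'I_n.+1, (i < j)%N -> P i `<` P j).

(* [krull_dim d]: d is the supremum in nat of the lengths of chains of primes.
   It holds for no d if the lengths are unbounded; the zero ring, which has
   no primes, gets dimension 0, the supremum of the empty set in nat. *)
Definition krull_dim : set nat :=
  supremums [set n | exists P : 'I_n.+1 -> set A, prime_chain P].

Definition mul_set (I J : set A) : set A :=
  [set x | exists (n : nat) (a b : 'I_n -> A),
    (forall i, I (a i) /\ J (b i)) /\ x = \sum_(i < n) a i * b i].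

Definition pow_set (J : set A) (m : nat) : set A := iter m (mul_set J) setT.

Definition ann_set (S : set A) : set A := [set r | forall x, S x -> r * x = 0].

Definition ann_inf_set (J : set A) : set A :=
  \bigcup_(m in [set: nat]) ann_set (pow_set J m).

Lemma mul_pow_sub (J : ideal) m : pow_set J m.+1 `<=` pow_set J m.
Proof.
elim: m => [//|m IHm] _ [n [a [b [ab ->]]]].
exists n, a, b; split=> // i; have [Ja Jb] := ab i.
by split=> //; apply: IHm.
Qed.

Lemma pow_sub (J : ideal) m n :
  (m <= n)%N -> pow_set J n `<=` pow_set J m.
Proof.
move=> /subnK <-; elim: (n - m)%N => [//|k IHk].
by rewrite addSn; apply: subset_trans IHk; apply: mul_pow_sub.
Qed.

Lemma ann_inf_ideal (J : ideal) : is_ideal (ann_inf_set J).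
Proof.
split; first by exists 0%N => // x _; rewrite mul0r.
- move=> x y [m _ xm] [n _ yn]; exists (maxn m n) => // z zmn.
  rewrite mulrDl xm ?yn ?addr0 //.
    by apply: pow_sub zmn; rewrite leq_maxr.
  by apply: pow_sub zmn; rewrite leq_maxl.
- by move=> a x [m _ xm]; exists m => // z zm; rewrite -mulrA xm ?mulr0.
Qed.

Definition ann_inf (J : ideal) : ideal := Ideal (ann_inf_ideal J).

End Ideals.

(* The library only quotients rings by proper ideals; 0 : J^oo is the unit
   ideal when J is nilpotent, so the quotient may be the zero ring. *)
Section QuotientRing.
Variables (A : comPzRingType) (I : ideal A).

Definition ideal_pred : A -> bool := fun x => `[< ideal_set I x >].

Lemma ideal_pred_zmod : zmod_closed ideal_pred.
Proof.
have [I0 ID IM] := idealP I.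
split; first exact/asboolP.
move=> x y /asboolP Ix /asboolP Iy; apply/asboolP.
by rewrite -mulN1r; apply: ID => //; apply: IM.
Qed.

Definition ideal_zmod : zmodClosed A :=
  HB.pack ideal_pred (GRing.isZmodClosed.Build A ideal_pred ideal_pred_zmod).

Definition quotient_ring : Type := Quotient.quot ideal_zmod.

HB.instance Definition _ := EqQuotient.on quotient_ring.
HB.instance Definition _ := GRing.Zmodule.on quotient_ring.

Definition quotient_mul (x y : quotient_ring) : quotient_ring :=
  \pi_quotient_ring (repr x * repr y).

Lemma quotient_eqP (x y : A) :
  reflect (ideal_set I (x - y)) (\pi_quotient_ring x == \pi_quotient_ring y).
Proof. by rewrite -Quotient.idealrBE; apply: (iffP (asboolP _)). Qed.

Lemma quotient_piM (x y : A) :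
  quotient_mul (\pi x) (\pi y) = \pi_quotient_ring (x * y).
Proof.
have [I0 ID IM] := idealP I.
apply/eqP/quotient_eqP.
set x' := repr _; set y' := repr _.
have Ix : ideal_set I (x' - x) by apply/quotient_eqP; rewrite reprK.
have Iy : ideal_set I (y' - y) by apply/quotient_eqP; rewrite reprK.
have -> : x' * y' - x * y = y' * (x' - x) + x * (y' - y).
  by rewrite !mulrBr (mulrC y' x') (mulrC y' x) addrA subrK.
by apply: ID; apply: IM.
Qed.

Lemma quotient_mulA : associative quotient_mul.
Proof.
elim/quotW=> x; elim/quotW=> y; elim/quotW=> z.
by rewrite (quotient_piM y z) (quotient_piM x y) !quotient_piM mulrA.
Qed.

Lemma quotient_mulC : commutative quotient_mul.
Proof. by move=> x y; rewrite /quotient_mul mulrC. Qed.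

Lemma quotient_mul1 : left_id (\pi_quotient_ring 1) quotient_mul.
Proof. by elim/quotW=> x; rewrite quotient_piM mul1r. Qed.

Lemma quotient_piD (x y : A) :
  \pi_quotient_ring x + \pi_quotient_ring y = \pi_quotient_ring (x + y).
Proof. exact: esym (Quotient.pi_add ideal_zmod x y). Qed.

Lemma quotient_mulDl : left_distributive quotient_mul +%R.
Proof.
elim/quotW=> x; elim/quotW=> y; elim/quotW=> z.
rewrite (quotient_piM x z) (quotient_piM y z) !quotient_piD quotient_piM.
by rewrite mulrDl.
Qed.

HB.instance Definition _ := GRing.Zmodule_isComPzRing.Build quotient_ring
  quotient_mulA quotient_mulC quotient_mul1 quotient_mulDl.

End QuotientRing.

Definition analytically_independent (R : comUnitRingType) (M : set R)
    (s : nat) (a : 'I_s -> R) : Prop :=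
  (forall i, a i != 0 /\ a i \isn't a GRing.unit) /\
  (forall (d : nat) (p : {mpoly R[s]}), p \is d.-homog -> p.@[a] = 0 ->
     forall m : 'X_{1..s}, M p@_m).

(* Analytically independent elements are pairwise distinct (consider x_i - x_j),
   so counting families or sets of elements of J is the same. *)
Definition analytic_lengths (R : comUnitRingType) (M J : set R) : set nat :=
  [set s | exists a : 'I_s -> R,
     (forall i, J (a i)) /\ analytically_independent M a].

Definition is_max (S : set nat) (d : nat) : Prop :=
  S d /\ forall s, S s -> (s <= d)%N.

(* Main.v *)
Require Import Defs.
From HB Require Import structures.
From mathcomp Require Import all_boot all_order all_algebra.
From mathcomp Require Import generic_quotient.
From mathcomp Require Import boolp classical_sets.
From mathcomp Require Import mpoly.

(* Write [I] for [0 : J^oo].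

   Upper bound.  Let [a_0, .., a_n] in [J] be analytically independent.  The
   values at [a] of the forms with some coefficient outside [M] are closed under
   products and avoid [0], so some prime [p] contains none of them; as
   [a_0 \notin p], [I] is contained in [p].  In [R[X_0, .., X_n]] the kernels of
   the substitutions [X_i := (a_i / a_0) X_0], [i <= j], into [(R / p)_(a_0)[X]]
   are primes [pR[X] = q_0 < .. < q_n], and [q_n < MR[X]] by the choice of [p].
   Now [M] is minimal over [p + (y_1, .., y_e)] for some [e <= dim R / p], hence
   [MR[X]] is minimal over [pR[X] + (y)], and Krull's height theorem in [R[X]]
   gives [n + 1 <= e].

   Lower bound.  A longest chain of primes over [I] can be taken to start at a
   prime [p] not containing [J].  A system of parameters [y_i] of [R / p] is
   analytically independent, and so are the [c y_i] for [c] in [J] outside [p].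

   Everything is phrased with ideals of [R] and of [R[X]] containing a given
   prime, so that no quotient or localization has to be constructed. *)

Set Implicit Arguments.
Unset Strict Implicit.
Unset Printing Implicit Defensive.

Import GRing.Theory.

Local Open Scope ring_scope.
Local Open Scope classical_set_scope.

(** * Ideals, primes and Noetherian induction *)

Section IdealTheory.
Variable A : comPzRingType.
Implicit Types (I J K P Q S : set A) (s : seq A).

Lemma ideal0 I : is_ideal I -> I 0. Proof. by case. Qed.

Lemma idealD I x y : is_ideal I -> I x -> I y -> I (x + y).
Proof. by case=> _ ID _; apply: ID. Qed.

Lemma ideal_mull I a x : is_ideal I -> I x -> I (a * x).
Proof. by case=> _ _ IM; apply: IM. Qed.

Lemma ideal_mulr I a x : is_ideal I -> I x -> I (x * a).
Proof. by move=> idI Ix; rewrite mulrC; apply: ideal_mull. Qed.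

Lemma idealN I x : is_ideal I -> I x -> I (- x).
Proof. by move=> idI Ix; rewrite -mulN1r; apply: ideal_mull. Qed.

Lemma idealB I x y : is_ideal I -> I x -> I y -> I (x - y).
Proof. by move=> idI Ix Iy; apply: idealD => //; apply: idealN. Qed.

Lemma ideal_subr I x y : is_ideal I -> I (x - y) -> I y -> I x.
Proof. by move=> idI Ixy Iy; rewrite -(subrK y x); apply: idealD. Qed.

Lemma ideal_sum I (T : Type) (r : seq T) (p : pred T) (F : T -> A) :
  is_ideal I -> (forall i, p i -> I (F i)) -> I (\sum_(i <- r | p i) F i).
Proof.
move=> idI IF; apply: big_ind => //; first exact: ideal0.
by move=> x y; apply: idealD.
Qed.

Lemma ideal_is_full I : is_ideal I -> I 1 -> I = setT.
Proof.
move=> idI I1; apply/seteqP; split=> // x _.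
by rewrite -(mulr1 x); apply: ideal_mull.
Qed.

Lemma prime_ideal P : is_prime P -> is_ideal P. Proof. by case. Qed.

Lemma prime1 P : is_prime P -> ~ P 1. Proof. by case. Qed.

Lemma primeM P x y : is_prime P -> P (x * y) -> P x \/ P y.
Proof. by case=> _ _; apply. Qed.

Lemma primeMn P x y : is_prime P -> ~ P x -> ~ P y -> ~ P (x * y).
Proof. by move=> prP nx ny /(primeM prP)[]. Qed.

Lemma primeX P x n : is_prime P -> P (x ^+ n) -> P x.
Proof.
move=> prP; elim: n => [|n IHn]; first by rewrite expr0 => /(prime1 prP).
by rewrite exprS => /(primeM prP)[].
Qed.

Definition colon I (g : A) : set A := [set x | I (x * g)].

Lemma colon_ideal I g : is_ideal I -> is_ideal (colon I g).
Proof.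
move=> idI; split; rewrite /colon /=.
- by rewrite mul0r; apply: ideal0.
- by move=> x y Ix Iy; rewrite mulrDl; apply: idealD.
- by move=> a x Ix; rewrite -mulrA; apply: ideal_mull.
Qed.

Definition adjoin I (g : A) : set A :=
  [set x | exists y r, I y /\ x = y + r * g].

Lemma adjoin_ideal I g : is_ideal I -> is_ideal (adjoin I g).
Proof.
move=> idI; split.
- by exists 0, 0; rewrite mul0r addr0; split=> //; apply: ideal0.
- move=> _ _ [y [r [Iy ->]]] [z [t [Iz ->]]].
  exists (y + z), (r + t); split; first exact: idealD.
  by rewrite mulrDl addrACA.
- move=> a _ [y [r [Iy ->]]]; exists (a * y), (a * r); split.
    exact: ideal_mull.
  by rewrite mulrDr mulrA.
Qed.

Lemma sub_adjoin I g : I `<=` adjoin I g.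
Proof. by move=> x Ix; exists x, 0; rewrite mul0r addr0. Qed.

Lemma adjoin_gen I g : is_ideal I -> adjoin I g g.
Proof.
by move=> idI; exists 0, 1; rewrite mul1r add0r; split=> //; apply: ideal0.
Qed.

Lemma adjoin_sub I K g : is_ideal K -> I `<=` K -> K g -> adjoin I g `<=` K.
Proof.
move=> idK IK Kg _ [y [r [Iy ->]]]; apply: idealD => //; first exact: IK.
exact: ideal_mull.
Qed.

Lemma adjoin_proper I g : is_ideal I -> ~ I g -> I `<` adjoin I g.
Proof.
move=> idI nIg; split; first exact: sub_adjoin.
by move=> /(_ g (adjoin_gen g idI)).
Qed.

(* [s] generates [I], expressed without linear combinations. *)
Definition generates s I : Prop :=
  (forall x, x \in s -> I x) /\
  forall K, is_ideal K -> (forall x, x \in s -> K x) -> I `<=` K.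

Lemma noetherian_gen : noetherian A ->
  forall I, is_ideal I -> exists s, generates s I.
Proof.
move=> noethA I idI; have [n [g defI]] := noethA I idI.
exists (codom g); split.
  move=> _ /codomP[i ->]; rewrite defI; exists (fun j => (j == i)%:R).
  rewrite (bigD1 i) //= eqxx mul1r big1 ?addr0 // => j /negPf->.
  by rewrite mul0r.
move=> K idK Kg x; rewrite defI => -[c ->]; apply: ideal_sum => // i _.
by apply: ideal_mull => //; apply: Kg; apply: codom_f.
Qed.

Lemma gen_noetherian :
  (forall I, is_ideal I -> exists s, generates s I) -> noetherian A.
Proof.
move=> genA I idI; have [s [sI Is]] := genA I idI.
exists (size s), (fun i => s`_i); apply/seteqP; split; last first.
  move=> _ [c ->]; apply: ideal_sum => // i _; apply: ideal_mull => //.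
  by apply: sI; apply: mem_nth.
apply: Is.
  split; first by exists (fun=> 0); rewrite big1 // => i _; rewrite mul0r.
    move=> _ _ [c ->] [d ->]; exists (fun i => c i + d i).
    by rewrite -big_split; apply: eq_bigr => i _; rewrite mulrDl.
  move=> a _ [c ->]; exists (fun i => a * c i).
  by rewrite big_distrr; apply: eq_bigr => i _; rewrite /= mulrA.
move=> x /(nthP 0)[i lti <-]; exists (fun j => (j == Ordinal lti)%:R).
rewrite (bigD1 (Ordinal lti)) //= eqxx mul1r big1 ?addr0 // => j /negPf->.
by rewrite mul0r.
Qed.

Section Noetherian.
Hypothesis noethA : noetherian A.

(** Otherwise choice yields a strictly increasing sequence of bad ideals; the generators of its
    union already lie in one term. *)
Lemma noeth_ind (p : set A -> Prop) :
  (forall I, is_ideal I -> (forall K, is_ideal K -> I `<` K -> p K) -> p I) ->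
  forall I, is_ideal I -> p I.
Proof.
move=> IHp I0 idI0; apply: contrapT => npI0.
pose bad := {I : set A | is_ideal I /\ ~ p I}.
have next (I : bad) : exists K : bad, sval I `<` sval K.
  case: I => I [idI npI] /=; apply: contrapT => nK; apply: npI.
  apply: IHp => // K idK ltIK; apply: contrapT => npK; apply: nK.
  by exists (exist _ K (conj idK npK)).
have [f fP] := choice next.
pose F n := sval (iter n f (exist _ I0 (conj idI0 npI0)) : bad).
have idF n : is_ideal (F n) by rewrite /F; case: (iter _ _ _) => K [].
have ltF n : F n `<` F n.+1 by apply: fP.
have leF m n : (m <= n)%N -> F m `<=` F n.
  move=> /subnK <-; elim: (n - m)%N => // k IHk; rewrite addSn.
  by apply: (subset_trans IHk); case: (ltF (k + m)%N).
pose U := [set x | exists n, F n x].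
have idU : is_ideal U.
  split; first by exists 0%N; apply: ideal0.
    move=> x y [m Fx] [n Fy]; exists (maxn m n).
    by apply: idealD => //; [apply: leF Fx|apply: leF Fy];
       rewrite ?leq_maxl ?leq_maxr.
  by move=> a x [n Fx]; exists n; apply: ideal_mull.
have [s [sU Us]] := noetherian_gen noethA idU.
have [n Fs] : exists n, forall x, x \in s -> F n x.
  elim: s {Us} sU => [|y s IHs] sU; first by exists 0%N.
  have [|n Fn] := IHs; first by move=> x xs; apply: sU; rewrite inE xs orbT.
  have [m Fm] : U y by apply: sU; rewrite mem_head.
  exists (maxn m n) => x; rewrite inE => /orP[/eqP->|/Fn Fx].
    by apply: leF Fm; rewrite leq_maxl.
  by apply: leF Fx; rewrite leq_maxr.
have [_] := ltF n; apply=> x Fx.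
by apply: (Us _ (idF n) Fs); exists n.+1.
Qed.

(** Associated primes exist: a maximal ideal among the [colon K g] is prime, for if [u * v] violates
    primality then [colon K (u * g)] is larger, containing [v]. *)
Lemma prime_colon_exists K :
  is_ideal K -> ~ K 1 -> exists g, ~ K g /\ is_prime (colon K g).
Proof.
move=> idK nK1.
suff: forall I, is_ideal I -> forall g, ~ K g -> I = colon K g ->
    exists g, ~ K g /\ is_prime (colon K g).
  by move/(_ _ (colon_ideal 1 idK) 1); apply.
apply: noeth_ind => I _ IH g nKg defI; rewrite {}defI {I} in IH.
apply: contrapT => no_prime; apply: (no_prime); exists g; split=> //.
split; [exact: colon_ideal | by rewrite /colon /= mul1r|].
move=> u v; rewrite /colon /= => Kuvg; apply: contrapT => /not_orP[nKu nKv].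
apply: no_prime.
apply: (IH (colon K (u * g)) (colon_ideal _ idK) _ (u * g)) => //.
split=> [x|/(_ v)]; rewrite /colon /=.
  by move=> Kxg; rewrite mulrCA; apply: ideal_mull.
by rewrite mulrCA mulrA => /(_ Kuvg).
Qed.

(** [P] is an associated prime, with witness [g], of the contraction [L] of [I] from the
    localization at [S]. The last two conclusions record this without mentioning [L]. *)
Lemma prime_avoiding I S : is_ideal I -> S 1 ->
    (forall x y, S x -> S y -> S (x * y)) -> (forall x, S x -> ~ I x) ->
  exists g P, [/\ is_prime P, I `<=` P, forall x, S x -> ~ P x,
    forall w, S w -> ~ I (w * g) & forall r, P r ->
      exists2 w, S w & I (r * (w * g))].
Proof.
move=> idI S1 SM SI.
pose L := [set r | exists2 w, S w & I (w * r)].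
have idL : is_ideal L.
  split; first by exists 1; rewrite // mulr0; apply: ideal0.
    move=> x y [w Sw Iwx] [v Sv Ivy]; exists (w * v); first exact: SM.
    rewrite mulrDr; apply: idealD => //; last first.
      by rewrite -mulrA; apply: ideal_mull.
    by rewrite mulrAC; apply: ideal_mulr.
  by move=> a x [w Sw Iwx]; exists w => //; rewrite mulrCA; apply: ideal_mull.
have [|g [nLg prP]] := prime_colon_exists idL.
  by case=> w Sw; rewrite mulr1; apply: SI.
exists g, (colon L g); split=> //.
- by move=> x Ix; exists 1 => //; rewrite mul1r; apply: ideal_mulr.
- move=> x Sx [w Sw Iwxg]; apply: nLg; exists (w * x); first exact: SM.
  by rewrite -mulrA.
- by move=> w Sw Iwg; apply: nLg; exists w.
- by move=> r [w Sw]; rewrite mulrCA; exists w.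
Qed.

Lemma sub_maximal I : is_ideal I -> ~ I 1 ->
  exists2 N, is_maximal N & I `<=` N.
Proof.
move: I; apply: noeth_ind => I idI IH nI1.
have [maxI|nmaxI] := EM (is_maximal I); first by exists I.
have [K [idK ltIK nK1]] : exists K, [/\ is_ideal K, I `<` K & ~ K 1].
  apply: contrapT => noK; apply: nmaxI; split=> // [|K idK leIK].
    by apply/eqP=> IT; apply: nI1; rewrite IT.
  have [K1|nK1] := EM (K 1); first by right; apply: ideal_is_full.
  left; apply/seteqP; split=> // x Kx; apply: contrapT => nIx.
  by apply: noK; exists K; split=> //; split=> // /(_ x Kx).
have [N maxN leKN] := IH K idK ltIK nK1.
by exists N => //; apply: subset_trans leKN; case: ltIK.
Qed.

Definition minimal_over I P : Prop :=
  forall Q, is_prime Q -> I `<=` Q -> Q `<=` P -> P `<=` Q.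

(* A localized form of "a Noetherian local ring with a single prime is
   Artinian", for the ring [A_P / I A_P]. *)
Lemma minimal_dcc P I : is_prime P -> is_ideal I -> minimal_over I P ->
  forall F : nat -> set A, (forall n, is_ideal (F n)) ->
    (forall n, I `<=` F n) -> (forall n, F n.+1 `<=` F n) ->
  exists n, forall x, F n x -> exists2 u, ~ P u & F n.+1 (u * x).
Proof.
move=> prP; move: I; apply: noeth_ind => I idI IH minP F idF leIF decF.
have [I1|nI1] := EM (I 1).
  exists 0%N => x _; exists 1; first exact: prime1.
  by apply: leIF; rewrite (ideal_is_full idI I1).
have [g [nIg prg]] := prime_colon_exists idI nI1.
have minP' : minimal_over (adjoin I g) P.
  move=> Q prQ leQ; apply: minP => //.
  by apply: subset_trans leQ; apply: sub_adjoin.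
(* Induction modulo [g]: the sequence stabilizes at [P] up to multiples of [g]. *)
have {IH} IH (G : nat -> set A) : (forall n, is_ideal (G n)) ->
    (forall n, I `<=` G n) -> (forall n, G n.+1 `<=` G n) ->
  exists n, forall x, G n x ->
    exists u, [/\ ~ P u & exists r, G n.+1 (u * x - r * g)].
  move=> idG leIG decG.
  have [|||n nP] := IH _ (adjoin_ideal g idI) (adjoin_proper idI nIg) minP'
      (fun n => adjoin (G n) g).
  - by move=> n; apply: adjoin_ideal.
  - move=> n; apply: adjoin_sub; first exact: adjoin_ideal.
      by apply: subset_trans (@sub_adjoin _ _).
    exact: adjoin_gen.
  - move=> n; apply: adjoin_sub; first exact: adjoin_ideal.
      by apply: subset_trans (@sub_adjoin _ _).
    exact: adjoin_gen.
  exists n => x Gx.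
  have [u nPu [y [r [Gy uxE]]]] := nP _ (sub_adjoin g Gx).
  by exists u; split=> //; exists r; rewrite uxE addrK.
(* If [g] is in every [F n] after localizing at [P], the error term [r * g] is harmless. *)
have [gF|] := EM (forall n, exists2 u, ~ P u & F n (u * g)).
  have [n nP] := IH F idF leIF decF.
  exists n => x Fx; have [u [nPu [r Fur]]] := nP x Fx.
  have [v nPv Fvg] := gF n.+1.
  exists (v * u); first exact: primeMn.
  apply: (@ideal_subr _ _ (r * (v * g))) => //; last exact: ideal_mull.
  by rewrite mulrCA -(mulrA v u) -mulrBr; apply: ideal_mull.
move=> /existsNP[N gN].
have leF n : F (N + n)%N `<=` F N.
  elim: n => [|n IHn]; first by rewrite addn0.
  by rewrite addnS; apply: subset_trans IHn.
have [|n nP] := IH (fun n => F (N + n)%N) (fun=> idF _) (fun=> leIF _).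
  by move=> n; rewrite addnS; apply: decF.
(* Now the prime [colon I g] lies in [P], as [g] avoids the localization of [F N]; by minimality it
   is [P]. Error terms [r * g] with [r] in [P] thus fall into [I]. *)
have Pg : P `<=` colon I g.
  apply: minP => //; first by move=> x Ix; apply: ideal_mulr.
  move=> x xgI; apply: contrapT => nPx; apply: gN; exists x => //.
  exact: leIF.
exists (N + n)%N => x Fx; have [u [nPu [r Fur]]] := nP x Fx.
rewrite addnS in Fur; exists u => //; apply: (ideal_subr _ Fur) => //.
apply: leIF; apply: Pg; apply: contrapT => nPr; apply: gN; exists r => //.
apply: (@leF n); rewrite -[_ * _](subKr (u * x)).
by apply: idealB => //; [apply: ideal_mull|apply: decF].
Qed.

End Noetherian.

(* Nakayama's lemma for [A_P], with denominators cleared. *)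
Lemma local_nakayama P N k (g : 'I_k -> A) : is_prime P -> is_ideal N ->
    (forall i, exists u (c : 'I_k -> A), [/\ ~ P u, forall j, P (c j) &
       N (u * g i - \sum_j c j * g j)]) ->
  exists2 t, ~ P t & forall i, N (t * g i).
Proof.
move=> prP idN; have idP := prime_ideal prP.
elim: k g => [|k IHk] g relg; first by exists 1; [apply: prime1|case].
have [u [c [nPu Pc Nc]]] := relg ord_max.
rewrite big_ord_recr /= in Nc.
(* [w] is outside [P], so the last relation gives [w * g ord_max] in terms of the other generators
   and eliminates it from their relations. *)
pose w := u - c ord_max.
have nPw : ~ P w by move=> Pw; apply: nPu; apply: (ideal_subr _ Pw).
pose wd := fun i : 'I_k => widen_ord (leqnSn k) i.
have Nw : N (w * g ord_max - \sum_(j < k) c (wd j) * g (wd j)).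
  by rewrite mulrBl -addrA -opprD addrC [X in - X]addrC addrC.
have [|t nPt Nt] := IHk (fun i => g (wd i)).
  move=> i; have [v [d [nPv Pd Nd]]] := relg (wd i).
  exists (w * v), (fun j => w * d (wd j) + d ord_max * c (wd j)); split.
  - exact: primeMn.
  - by move=> j; apply: idealD => //; apply: ideal_mull.
  rewrite big_ord_recr /= in Nd.
  have := idealD idN (ideal_mull w idN Nd) (ideal_mull (d ord_max) idN Nw).
  congr N; rewrite mulrBr mulrDr mulrBr.
  under [X in _ = _ - X]eq_bigr do rewrite mulrDl -!mulrA.
  rewrite big_split /= -!big_distrr /= !opprD -mulrA.
  rewrite -!addrA; congr (_ + _); congr (_ + _).
  by rewrite mulrCA addKr.
exists (t * w); first exact: primeMn.
move=> i; have [ltik|] := ltnP i k.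
  have -> : i = wd (Ordinal ltik) by apply: val_inj.
  by rewrite mulrAC; apply: ideal_mulr.
move=> leki; have -> : i = ord_max.
  by apply: val_inj; apply/eqP; rewrite eqn_leq leki -ltnS ltn_ord.
apply: (ideal_subr idN (y := t * \sum_(j < k) c (wd j) * g (wd j))).
  by rewrite -mulrA -mulrBr; apply: ideal_mull.
rewrite big_distrr; apply: ideal_sum => // j _ /=; rewrite mulrCA.
exact: ideal_mull.
Qed.

End IdealTheory.

(** * Krull's height theorem and systems of parameters *)

Section Chains.
Variable A : comPzRingType.
Implicit Types (I J K M P Q : set A) (s : seq A) (l : seq (set A)).

(* The last prime of the chain need only be contained in [P]. *)
Fixpoint chain_below n Q P : Prop :=
  if n is n'.+1 then exists Q', [/\ is_prime Q', Q `<` Q' & chain_below n' Q' P]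
  else Q `<=` P.

Lemma chain_below_sub n Q P : chain_below n Q P -> Q `<=` P.
Proof.
elim: n Q => [//|n IHn] Q [Q' [_ [leQ _] /IHn leQ'P]].
exact: subset_trans leQ'P.
Qed.

Lemma chain_below_fun (F : nat -> set A) n P :
  (forall i, (i <= n)%N -> is_prime (F i)) ->
  (forall i, (i < n)%N -> F i `<` F i.+1) -> F n `<=` P ->
  chain_below n (F 0%N) P.
Proof.
elim: n F => [//|n IHn] F prF ltF leFP.
exists (F 1%N); split; [exact: prF | exact: ltF|].
by apply: (IHn (fun i => F i.+1)) => // i lti; [apply: prF|apply: ltF].
Qed.

Lemma fun_chain_below n Q P : is_prime Q -> chain_below n Q P ->
  exists F : nat -> set A, [/\ F 0%N = Q,
    forall i, (i <= n)%N -> is_prime (F i) &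
    forall i, (i < n)%N -> F i `<` F i.+1].
Proof.
elim: n Q => [|n IHn] Q prQ.
  by exists (fun=> Q).
case=> Q' [prQ' ltQ /(IHn _ prQ')[F [F0 prF ltF]]].
exists (fun i => if i is i'.+1 then F i' else Q); split=> //; case=> //=.
by rewrite F0.
Qed.

Section Height.
Hypothesis noethA : noetherian A.

(* If [P] were minimal over [Q0 + (y)], then
   for [z] in [Q1 \ Q0] the contractions [W n] of [Q0 + (z ^ n)] from the
   localization at [Q1] would stabilize in the localization at [P]. *)
Lemma principal_ideal_theorem Q0 Q1 P y :
    is_prime Q0 -> is_prime Q1 -> is_prime P -> Q0 `<` Q1 -> Q1 `<` P -> P y ->
  exists Q, [/\ is_prime Q, Q0 `<` Q, Q `<` P & Q y].
Proof.
move=> prQ0 prQ1 prP ltQ01 ltQ1P Py; apply: contrapT => noQ.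
have [[le01 nle10] [le1P _]] := (ltQ01, ltQ1P).
have [id0 id1] := (prime_ideal prQ0, prime_ideal prQ1).
have nQ1y : ~ Q1 y by move=> Q1y; apply: noQ; exists Q1.
have minP : minimal_over (adjoin Q0 y) P.
  move=> Q prQ leQ leQP; apply: contrapT => nlePQ; apply: noQ; exists Q.
  have Qy : Q y by apply: leQ; apply: adjoin_gen.
  split=> //; split; first by apply: subset_trans leQ; apply: sub_adjoin.
  by move=> leQQ0; apply: nQ1y; apply/le01/leQQ0.
have [z [Q1z nQ0z]] : exists z, Q1 z /\ ~ Q0 z.
  apply: contrapT => noz; apply: nle10 => z Q1z; apply: contrapT => nQ0z.
  by apply: noz; exists z.
pose W n := [set x | exists2 v, ~ Q1 v & adjoin Q0 (z ^+ n) (v * x)].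
have idW n : is_ideal (W n).
  have idz := adjoin_ideal (z ^+ n) id0.
  split; first by exists 1; [apply: prime1|rewrite mulr0; apply: ideal0].
    move=> x1 x2 [v1 nv1 zx1] [v2 nv2 zx2]; exists (v1 * v2).
      exact: primeMn.
    rewrite mulrDr; apply: idealD => //; last first.
      by rewrite -mulrA; apply: ideal_mull.
    by rewrite mulrAC; apply: ideal_mulr.
  by move=> a x [v nv zx]; exists v => //; rewrite mulrCA; apply: ideal_mull.
have leW n : Q0 `<=` W n.
  move=> x Q0x; exists 1; first exact: prime1.
  by rewrite mul1r; apply: sub_adjoin.
have decW n : W n.+1 `<=` W n.
  move=> x [v nv zx]; exists v => //; apply: adjoin_sub zx.
  - exact: adjoin_ideal.
  - exact: sub_adjoin.
  - by rewrite exprS; apply: ideal_mull;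
      [apply: adjoin_ideal|apply: adjoin_gen].
have [|||n nP] := minimal_dcc noethA prP (adjoin_ideal y id0) minP
    (F := fun n => adjoin (W n) y).
- by move=> n; apply: adjoin_ideal.
- move=> n; apply: adjoin_sub; first exact: adjoin_ideal.
    exact: subset_trans (leW n) (@sub_adjoin _ _ _).
  exact: adjoin_gen.
- move=> n; apply: adjoin_sub; first exact: adjoin_ideal.
    exact: subset_trans (decW n) (@sub_adjoin _ _ _).
  exact: adjoin_gen.
(* [r * y] lies in [W n], and [y], being outside [Q1], cancels because [W n] is contracted from the
   localization at [Q1]. *)
have WnP x : W n x ->
    exists u r, [/\ ~ P u, W n r & W n.+1 (u * x - y * r)].
  move=> Wx; have [u nPu [x' [r [Wx' uxE]]]] := nP x (sub_adjoin y Wx).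
  exists u, r; split=> //; last by rewrite uxE mulrC addrK.
  have [v nv Iv] : W n (r * y).
    rewrite -[r * y](addKr x') -uxE addrC; apply: idealB => //.
      exact: ideal_mull.
    exact: decW.
  exists (v * y); first exact: primeMn.
  by rewrite -mulrA (mulrC y).
have [k [g defW]] := noethA (idW n).
have Wg i : W n (g i).
  rewrite defW; exists (fun j => (j == i)%:R).
  rewrite (bigD1 i) //= eqxx mul1r big1 ?addr0 // => j /negPf->.
  by rewrite mul0r.
have [|t nPt Wt] := @local_nakayama _ P _ _ g prP (idW n.+1).
  move=> i; have [u [r [nPu]]] := WnP _ (Wg i).
  rewrite {1}defW => -[c ->] Wu; exists u, (fun j => y * c j); split=> //.
    by move=> j; apply: ideal_mulr => //; apply: prime_ideal.
  by under eq_bigr do rewrite -mulrA; rewrite -big_distrr.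
have [v nv [q [r [Q0q tzE]]]] : W n.+1 (t * z ^+ n).
  have : W n (z ^+ n).
    exists 1; first exact: prime1.
    by rewrite mul1r; apply: adjoin_gen.
  rewrite defW => -[c ->]; rewrite big_distrr; apply: ideal_sum => // i _ /=.
  by rewrite mulrCA; apply: ideal_mull.
(* As [z] is not in [Q0], the second factor is; but modulo [Q1] it equals [v * t], and neither [v]
   nor [t] is in [Q1]. *)
have : Q0 (z ^+ n * (v * t - r * z)).
  rewrite mulrBr [_ * (r * z)]mulrCA -exprSr mulrC -mulrA tzE addrK.
  exact: Q0q.
case/(primeM prQ0) => [/(primeX prQ0)//|/le01 Q1vt].
apply: (primeMn prQ1 nv (x := v) (y := t)); first by move=> /le1P.
by apply: (ideal_subr id1 Q1vt); apply: ideal_mull.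
Qed.

(** Starting from [P] at the top, [y] is moved down one prime at a time: if [Q2] contains [y], the
    principal ideal theorem for [Q < Q1 < Q2] replaces [Q1] by a prime containing [y]. *)
Lemma chain_below_through n Q P y : is_prime Q -> is_prime P -> P y ->
    chain_below n.+1 Q P ->
  exists Q', [/\ is_prime Q', Q `<` Q', Q' y & chain_below n Q' P].
Proof.
move=> prQ prP Py; elim: n Q prQ => [|n IHn] Q prQ [Q1 [prQ1 ltQ1 chQ1]].
  case: ltQ1 => leQ nleQ; exists P; split=> //; split.
    exact: subset_trans chQ1.
  by move=> lePQ; apply: nleQ; apply: subset_trans lePQ.
have [Q2 [prQ2 lt12 Q2y chQ2]] := IHn Q1 prQ1 chQ1.
have [Q' [prQ' ltQ' lt'2 Q'y]] :=
  principal_ideal_theorem prQ prQ1 prQ2 ltQ1 lt12 Q2y.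
by exists Q'; split=> //; exists Q2.
Qed.

(** Rerouting the chain through [y] and dropping its first prime removes one generator and one step
    at a time. *)
Lemma krull_height Q P s n : is_prime Q -> is_prime P ->
    (forall y, y \in s -> P y) ->
    minimal_over (Q `|` [set y | y \in s]) P ->
  chain_below n Q P -> (n <= size s)%N.
Proof.
move=> prQ prP; elim: s n Q prQ => [|y s IHs] [|n] Q prQ sP minP //.
  case=> Q' [_ [leQ nleQ] /chain_below_sub leQ'P]; case: nleQ.
  apply: (subset_trans leQ'P); apply: minP => //; first by move=> x [].
  exact: subset_trans leQ'P.
move=> chQ.
have [Q' [prQ' [ltQ _] Q'y chQ']] :=
  chain_below_through prQ prP (sP y (mem_head _ _)) chQ.
apply: (IHs n Q') => // [x xs|Q2 prQ2 leQ2].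
  by apply: sP; rewrite inE xs orbT.
apply: minP => // x [/ltQ Q'x|/=]; first by apply: leQ2; left.
rewrite inE => /orP[/eqP->|xs]; apply: leQ2; [by left|by right].
Qed.

(** If [u * v] is in [K] but neither factor is, every prime over [K] contains [adjoin K u] or
    [adjoin K v]. The list contains all minimal primes of [K]. *)
Lemma primes_over_finite K : is_ideal K -> exists l,
  (forall P, P \in l -> is_prime P /\ K `<=` P) /\
  forall Q, is_prime Q -> K `<=` Q -> exists2 P, P \in l & P `<=` Q.
Proof.
move: K; apply: noeth_ind => // K idK IH.
have [prK|nprK] := EM (is_prime K).
  exists [:: K]; split=> [P|Q _ leKQ]; first by rewrite inE => /eqP->; split.
  by exists K; rewrite ?mem_head.
have [K1|nK1] := EM (K 1).
  by exists [::]; split=> // Q prQ /(_ _ K1)/(prime1 prQ).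
have [u [v [Kuv nKu nKv]]] : exists u v, [/\ K (u * v), ~ K u & ~ K v].
  apply: contrapT => nouv; apply: nprK; split=> // u v Kuv.
  apply: contrapT => /not_orP[nKu nKv]; apply: nouv.
  by exists u, v.
have [lu [luP luQ]] := IH _ (adjoin_ideal u idK) (adjoin_proper idK nKu).
have [lv [lvP lvQ]] := IH _ (adjoin_ideal v idK) (adjoin_proper idK nKv).
exists (lu ++ lv); split=> [P|Q prQ leKQ].
  rewrite mem_cat => /orP[/luP|/lvP] [prP leP]; split=> //;
    by apply: subset_trans leP; apply: sub_adjoin.
have [Qu|Qv] := primeM prQ (leKQ _ Kuv).
  have [|P Pl leP] := luQ Q prQ; last by exists P; rewrite // mem_cat Pl.
  by apply: adjoin_sub => //; apply: prime_ideal.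
have [|P Pl leP] := lvQ Q prQ; last by exists P; rewrite // mem_cat Pl orbT.
by apply: adjoin_sub => //; apply: prime_ideal.
Qed.

End Height.

Lemma exists_in_setD I P : ~ I `<=` P -> exists2 x, I x & ~ P x.
Proof.
move=> nle; apply: contrapT => nox; apply: nle => x Ix.
by apply: contrapT => nPx; apply: nox; exists x.
Qed.

Lemma prime_avoidance I l : is_ideal I ->
    (forall P, P \in l -> is_prime P /\ ~ I `<=` P) ->
  exists2 y, I y & forall P, P \in l -> ~ P y.
Proof.
move=> idI; have [n] := ubnP (size l); elim: n l => // n IHn [|P l] ltl lP.
  by exists 0; first exact: ideal0.
have [prP nleIP] := lP P (mem_head _ _).
(* Avoiding [P] avoids the primes inside it; those that remain have elements outside [P]. *)
pose l' := [seq Q <- l | ~~ `[< Q `<=` P >]].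
have l'P Q : Q \in l' -> [/\ Q \in l, is_prime Q, ~ I `<=` Q & ~ Q `<=` P].
  rewrite mem_filter => /andP[/asboolPn nleQP Ql].
  by have [|prQ nleIQ] := lP Q; first by rewrite inE Ql orbT.
have [||y Iy l'y] := IHn l'.
- by rewrite size_filter; apply: (leq_ltn_trans (count_size _ _)); apply: ltl.
- by move=> Q /l'P[].
have avoid z : ~ P z -> (forall Q, Q \in l' -> ~ Q z) ->
    forall Q, Q \in P :: l -> ~ Q z.
  move=> nPz l'z Q; rewrite inE => /orP[/eqP->//|Ql].
  have [leQP|nleQP] := EM (Q `<=` P); first by move=> /leQP.
  by apply: l'z; rewrite mem_filter Ql andbT; apply/asboolPn.
have [Py|nPy] := EM (P y); last by exists y => //; apply: avoid.
(* When [y] falls into [P], adding a [z] outside [P] but inside all of [l'] repairs it; [z] is a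
   product of elements outside [P]. *)
have [z [Iz nPz l'z]] : exists z, [/\ I z, ~ P z & forall Q, Q \in l' -> Q z].
  elim: (l') l'P => [|Q k IHk] kP.
    by have [z Iz nPz] := exists_in_setD nleIP; exists z.
  have [|z [Iz nPz kz]] := IHk.
    by move=> Q' Qk; apply: kP; rewrite inE Qk orbT.
  have [_ prQ _ /exists_in_setD[x Qx nPx]] := kP Q (mem_head _ _).
  exists (x * z); split; [exact: ideal_mull | exact: primeMn|].
  move=> Q'; rewrite inE => /orP[/eqP->|Q'k].
    by apply: ideal_mulr => //; apply: prime_ideal.
  have [_ prQ' _ _] : [/\ Q' \in l, is_prime Q', ~ I `<=` Q' & ~ Q' `<=` P].
    by apply: kP; rewrite inE Q'k orbT.
  by apply: ideal_mull; [apply: prime_ideal|apply: kz].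
exists (y + z); first exact: idealD.
apply: avoid => [Pyz|Q Ql' Qyz].
  apply: nPz; have idP := prime_ideal prP.
  by rewrite -[z](addKr y) addrC; apply: idealB.
have [_ prQ _ _] := l'P Q Ql'; apply: (l'y Q Ql').
by rewrite -[y](addrK z); apply: idealB; [apply: prime_ideal| |apply: l'z].
Qed.

(** Each step adjoins a [y] of [M] outside the listed primes over [K] that do not contain [M]. A
    nontrivial chain over [adjoin K y] extends downwards by such a prime, so the bound drops by
    one. *)
Lemma system_of_parameters M K e : noetherian A -> is_prime M -> is_ideal K ->
    (forall n Q, is_prime Q -> K `<=` Q -> chain_below n Q M -> (n <= e)%N) ->
  exists s, [/\ (size s <= e)%N, forall y, y \in s -> M y &
                minimal_over (K `|` [set y | y \in s]) M].
Proof.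
move=> noethA prM; have idM := prime_ideal prM.
elim: e K => [|e IHe] K idK bound.
  exists [::]; split=> // Q prQ leKQ leQM; apply: contrapT => nleMQ.
  have /(bound 1%N Q prQ) : K `<=` Q by move=> x Kx; apply: leKQ; left.
  by move/(_ (ex_intro _ M (And3 prM (conj leQM nleMQ) (@subset_refl _ M)))).
have [l [lP lQ]] := primes_over_finite noethA idK.
pose l' := [seq Q <- l | ~~ `[< M `<=` Q >]].
have [|y My l'y] := @prime_avoidance M l' idM.
  by move=> P; rewrite mem_filter => /andP[/asboolPn nle /lP[]].
have [|n Q prQ leQ chQ|s [les sM minM]] := IHe (adjoin K y).
- exact: adjoin_ideal.
- have [|P Pl lePQ] := lQ Q prQ.
    by apply: subset_trans leQ; apply: sub_adjoin.
  have [leMP|nleMP] := EM (M `<=` P).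
    case: n chQ => // n [Q' [_ [_ nleQ'Q] /chain_below_sub leQ'M]].
    by case: nleQ'Q; apply: subset_trans lePQ; apply: subset_trans leMP.
  have [prP leKP] := lP P Pl; apply: (bound n.+1 P prP leKP).
  exists Q; split=> //; split=> // leQP; apply: (l'y P).
    by rewrite mem_filter Pl andbT; apply/asboolPn.
  by apply/leQP/leQ/adjoin_gen.
exists (y :: s); split=> //.
  by move=> x; rewrite inE => /orP[/eqP->|/sM].
move=> Q prQ leQ; apply: minM => // x [|xs]; last first.
  by apply: leQ; right; rewrite /= inE xs orbT.
apply: adjoin_sub; first exact: prime_ideal.
  by move=> a Ka; apply: leQ; left.
by apply: leQ; right; rewrite /= mem_head.
Qed.

End Chains.

(** * Hilbert's basis theorem and extension of primes to polynomial rings *)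

Section Morphisms.
Variables (A B : comPzRingType) (f : {rmorphism A -> B}).

Lemma ideal_preimage I : is_ideal I -> is_ideal (f @^-1` I).
Proof.
move=> idI; split; rewrite /preimage /=.
- by rewrite rmorph0; apply: ideal0.
- by move=> x y Ix Iy; rewrite rmorphD; apply: idealD.
- by move=> a x Ix; rewrite rmorphM; apply: ideal_mull.
Qed.

Lemma prime_preimage P : is_prime P -> is_prime (f @^-1` P).
Proof.
move=> prP; split; first by apply/ideal_preimage/prime_ideal.
  by rewrite /preimage /= rmorph1; apply: prime1.
by move=> u v; rewrite /preimage /= rmorphM => /(primeM prP).
Qed.

Lemma noetherian_surj :
  noetherian A -> (forall y, exists x, f x = y) -> noetherian B.
Proof.
move=> noethA f_surj; apply: gen_noetherian => I idI.
have [s [sI Is]] := noetherian_gen noethA (ideal_preimage idI).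
exists [seq f x | x <- s]; split=> [_ /mapP[x xs ->]|K idK Ks y Iy].
  exact: sI.
have [x fx] := f_surj y; rewrite -fx.
apply: (Is _ (ideal_preimage idK)) => [z zs|]; first exact/Ks/map_f.
by rewrite /preimage /= fx.
Qed.

End Morphisms.

Section Hilbert.
Variable A : comNzRingType.
Implicit Types (I K : set {poly A}).

(** Leading coefficients in degree [n]; the size bound also admits [f] of lower degree, which
    contributes [0]. *)
Definition coefs_below I n : set A :=
  [set c | exists f : {poly A}, [/\ I f, (size f <= n.+1)%N & f`_n = c]].

Lemma coefs_below_ideal I n : is_ideal I -> is_ideal (coefs_below I n).
Proof.
move=> idI; split.
- by exists 0; split; [exact: ideal0|rewrite size_poly0|rewrite coef0].
- move=> _ _ [f [If lef <-]] [g [Ig leg <-]]; exists (f + g).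
  split; [exact: idealD | | exact: coefD].
  by apply: leq_trans (size_polyD _ _) _; rewrite geq_max lef.
- move=> a _ [f [If lef <-]]; exists (a%:P * f).
  split; [exact: ideal_mull | | exact: coefCM].
  by rewrite mul_polyC; apply: leq_trans (size_scale_leq _ _) lef.
Qed.

Lemma coefs_belowS I m n : is_ideal I -> (m <= n)%N ->
  coefs_below I m `<=` coefs_below I n.
Proof.
move=> idI lemn _ [f [If lef <-]]; exists ('X^(n - m) * f).
split; first exact: ideal_mull.
  apply: leq_trans (size_polyMleq _ _) _; rewrite size_polyXn addSn /=.
  by apply: leq_trans (leq_add (leqnn _) lef) _; rewrite addnS subnK.
by rewrite coefXnM ltnNge leq_subr /= subKn.
Qed.

(** Subtracting a [g] in [I] and [K] with the same coefficient in degree [n] lowers the size. *)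
Lemma sub_of_coefs_below I K n (f : {poly A}) :
    is_ideal I -> is_ideal K -> I f -> (size f <= n.+1)%N ->
    coefs_below (I `&` K) n f`_n ->
    (forall g, I g -> (size g <= n)%N -> K g) -> K f.
Proof.
move=> idI idK If lef [g [[Ig Kg] leg gn]] IK.
apply: (@ideal_subr _ K f g) => //; apply: IK; first exact: idealB.
apply/leq_sizeP => j; rewrite coefB leq_eqVlt => /predU1P[<-|ltnj].
  by rewrite gn subrr.
by rewrite !nth_default ?subrr //;
  [apply: leq_trans leg _|apply: leq_trans lef _].
Qed.

Lemma idealI I K : is_ideal I -> is_ideal K -> is_ideal (I `&` K).
Proof.
move=> idI idK; split; first by split; apply: ideal0.
  by move=> x y [Ix Kx] [Iy Ky]; split; apply: idealD.
by move=> a x [Ix Kx]; split; apply: ideal_mull.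
Qed.

Lemma hilbert_basis : noetherian A -> noetherian {poly A}.
Proof.
move=> noethA; apply: gen_noetherian => I idI.
have lift n (s : seq A) : (forall c, c \in s -> coefs_below I n c) ->
    exists t : seq {poly A}, (forall f, f \in t -> I f) /\
      forall K, is_ideal K -> (forall f, f \in t -> K f) ->
        forall c, c \in s -> coefs_below (I `&` K) n c.
  elim: s => [|c s IHs] sI; first by exists [::].
  have [|t [tI tK]] := IHs.
    by move=> x xs; apply: sI; rewrite inE xs orbT.
  have [f [If lef fn]] := sI c (mem_head _ _).
  exists (f :: t); split=> [g|K idK Kft x].
    by rewrite inE => /orP[/eqP->//|/tI].
  rewrite inE => /orP[/eqP->|xs].
    by exists f; split=> //; split=> //; apply: Kft; rewrite mem_head.
  by apply: tK => // g gt; apply: Kft; rewrite inE gt orbT.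
have small n : exists t : seq {poly A}, (forall f, f \in t -> I f) /\
    forall K, is_ideal K -> (forall f, f \in t -> K f) ->
      forall f : {poly A}, I f -> (size f <= n)%N -> K f.
  elim: n => [|n [t [tI tK]]].
    exists [::]; split=> // K idK _ f _; rewrite leqn0 size_poly_eq0.
    by move=> /eqP->; apply: ideal0.
  have [s [sL Ls]] := noetherian_gen noethA (coefs_below_ideal n idI).
  have [t' [t'I t'K]] := lift n s sL.
  exists (t ++ t'); split=> [f|K idK Kt f If lef].
    by rewrite mem_cat => /orP[/tI|/t'I].
  apply: (sub_of_coefs_below idI idK If lef).
    apply: (Ls _ (coefs_below_ideal n (idealI idI idK))); last by exists f.
    by apply: t'K => // g gt; apply: Kt; rewrite mem_cat gt orbT.
  by apply: tK => // g gt; apply: Kt; rewrite mem_cat gt.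
pose L := [set c | exists n, coefs_below I n c].
have idL : is_ideal L.
  split.
  - by exists 0%N; apply: ideal0; apply: coefs_below_ideal.
  - move=> x y [m Lx] [n Ly]; exists (maxn m n).
    by apply: idealD; [exact: coefs_below_ideal
      |apply: coefs_belowS Lx|apply: coefs_belowS Ly];
      rewrite ?leq_maxl ?leq_maxr.
  - move=> a x [n Lx]; exists n.
    by apply: ideal_mull Lx; apply: coefs_below_ideal.
have [s [sL Ls]] := noetherian_gen noethA idL.
have [N sN] : exists N, forall c, c \in s -> coefs_below I N c.
  elim: s {Ls} sL => [|c s IHs] sL; first by exists 0%N.
  have [|N sN] := IHs; first by move=> x xs; apply: sL; rewrite inE xs orbT.
  have [n Ln] := sL c (mem_head _ _); exists (maxn n N) => x.
  rewrite inE => /orP[/eqP->|/sN Lx].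
    by apply: coefs_belowS Ln => //; rewrite leq_maxl.
  by apply: coefs_belowS Lx => //; rewrite leq_maxr.
(* [t] covers size at most [N]; in higher degrees the polynomials of [t'], multiplied by powers of
   ['X], realize the generators [s] of the leading coefficients. *)
have [t [tI tK]] := small N; have [t' [t'I t'K]] := lift N s sN.
exists (t ++ t'); split=> [f|K idK Kt f If].
  by rewrite mem_cat => /orP[/tI|/t'I].
have {}tK := tK K idK (fun g gt => Kt g ltac:(by rewrite mem_cat gt)).
have {}t'K := t'K K idK (fun g gt => Kt g ltac:(by rewrite mem_cat gt orbT)).
have idIK := idealI idI idK.
suff: forall n (g : {poly A}), I g -> (size g <= n)%N -> K g.
  by move/(_ (size f)); apply.
elim=> [|n IHn] g Ig leg; first by apply: tK => //; apply: leq_trans leg _.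
have [ltnN|leNn] := ltnP n N.
  by apply: tK => //; apply: leq_trans leg ltnN.
apply: (sub_of_coefs_below idI idK Ig leg) => //.
apply: (Ls _ (coefs_below_ideal n idIK)); last by exists n, g.
by move=> c /t'K; apply: coefs_belowS.
Qed.

End Hilbert.

(** * Extension of ideals and primes to multivariate polynomials *)

Section MPoly.
Variables (R : comNzRingType) (n : nat).
Implicit Types (P M : set R) (f g : {mpoly R[n]}).

Lemma mpoly_rmorph_ext (S : pzRingType)
    (phi psi : {rmorphism {mpoly R[n]} -> S}) :
    (forall c, phi c%:MP = psi c%:MP) -> (forall i, phi 'X_i = psi 'X_i) ->
  phi =1 psi.
Proof.
move=> eqC eqX f; rewrite (mpolyE f) !rmorph_sum; apply: eq_bigr => m _.
rewrite -mul_mpolyC !rmorphM eqC mpolyXE_id !rmorph_prod; congr (_ * _).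
by apply: eq_bigr => i _; rewrite !rmorphXn /= eqX.
Qed.

(** For an ideal [P] this is the extended ideal [P R[X]], described by coefficients. *)
Definition extension P : set {mpoly R[n]} := [set f | forall m, P f@_m].

Lemma extension_ideal P : is_ideal P -> is_ideal (extension P).
Proof.
move=> idP; split=> [m|f g Pf Pg m|f g Pg m].
- by rewrite mcoeff0; apply: ideal0.
- by rewrite mcoeffD; apply: idealD.
- by rewrite mcoeffM; apply: ideal_sum => // k _; apply: ideal_mull.
Qed.

Lemma extensionC P c : is_ideal P -> extension P c%:MP <-> P c.
Proof.
move=> idP; split=> [/(_ 0%MM)|Pc m]; first by rewrite mcoeffC eqxx mulr1.
by rewrite mcoeffC; apply: ideal_mulr.
Qed.

Lemma extension_sub P (K : set {mpoly R[n]}) : is_ideal K ->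
  (forall c, P c -> K c%:MP) -> extension P `<=` K.
Proof.
move=> idK PK f Pf; rewrite (mpolyE f); apply: ideal_sum => // m _.
by rewrite -mul_mpolyC; apply: ideal_mulr => //; apply: PK.
Qed.

(** Modulo [extension P] both factors can be trimmed so that their nonzero coefficients lie outside
    [P]; the leading coefficient of the product is then a product of two such. *)
Lemma extension_prime P : is_prime P -> is_prime (extension P).
Proof.
move=> prP; have idP := prime_ideal prP; have idE := extension_ideal idP.
split=> // [/(_ 0%MM)|f g Pfg]; first by rewrite mcoeff1 eqxx; apply: prime1.
have trim h : exists h', extension P (h - h') /\
    forall m, h'@_m = 0 \/ h'@_m = h@_m /\ ~ P h@_m.
  elim/mpolyind: h => [|c m h mh _ [h' [Ph h'P]]].
    exists 0; split=> [|m]; last by left; rewrite mcoeff0.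
    by rewrite subrr; apply: (ideal0 idE).
  have h'm : h'@_m = 0.
    by have [//|[-> _]] := h'P m; apply: memN_msupp_eq0.
  have [Pc|nPc] := EM (P c).
    exists h'; split.
      rewrite -addrA -mul_mpolyC; apply: (idealD idE) => //.
      apply: (ideal_mulr _ idE).
      by apply/extensionC.
    move=> k; have [->|/negPf nemk] := eqVneq k m; first by left.
    by rewrite mcoeffD mcoeffZ mcoeffX eq_sym nemk mulr0 add0r; apply: h'P.
  exists (c *: 'X_[m] + h'); split; first by rewrite opprD addrACA subrr add0r.
  move=> k; rewrite !mcoeffD mcoeffZ mcoeffX.
  have [<-|/negPf nemk] := eqVneq m k; last by rewrite mulr0 !add0r; apply: h'P.
  by right; rewrite h'm (memN_msupp_eq0 mh) mulr1 !addr0.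
have [f' [Pf f'P]] := trim f; have [g' [Pg g'P]] := trim g.
have Pf'g' : extension P (f' * g').
  have -> : f' * g' = f * g - ((f - f') * g + f' * (g - g')).
    by rewrite mulrBl mulrBr addrA subrK opprB addrC subrK.
  apply: (idealB idE) => //; apply: (idealD idE).
    exact: (ideal_mulr _ idE).
  exact: (ideal_mull _ idE).
have [f0|nzf] := eqVneq f' 0; first by left; rewrite f0 subr0 in Pf.
have [g0|nzg] := eqVneq g' 0; first by right; rewrite g0 subr0 in Pg.
have := Pf'g' (mlead f' + mlead g')%MM; rewrite mleadcM.
rewrite -!mleadc_eq0 in nzf nzg.
have [/eqP|[-> nPf]] := f'P (mlead f'); first by rewrite (negPf nzf).
have [/eqP|[-> nPg]] := g'P (mlead g'); first by rewrite (negPf nzg).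
by move=> /(primeM prP)[].
Qed.

Lemma extension_proper P M : is_ideal P -> is_ideal M -> P `<` M ->
  extension P `<` extension M.
Proof.
move=> idP idM [lePM nleMP]; split=> [f Pf m|leMP]; first exact: lePM.
by apply: nleMP => c Mc; apply/(extensionC _ idP)/leMP/extensionC.
Qed.

(** Such a [Q] contracts to a prime of [R] inside [M], which contains [M] by minimality. *)
Lemma extension_minimal P M (s : seq R) : is_ideal P -> is_prime M ->
    minimal_over (P `|` [set y | y \in s]) M ->
  minimal_over (extension P `|` [set g | g \in [seq y%:MP | y <- s]])
    (extension M).
Proof.
move=> idP prM minM Q prQ leQ leQM; have idM := prime_ideal prM.
pose c := @mpolyC n R : {rmorphism R -> {mpoly R[n]}}.
have prcQ : is_prime (c @^-1` Q) by apply: prime_preimage.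
apply: extension_sub; first exact: prime_ideal.
apply: (minM _ prcQ) => [x [Px|xs]|x].
- by apply: leQ; left; apply/extensionC.
- by apply: leQ; right; apply: map_f.
- by move=> /leQM/extensionC; apply.
Qed.

End MPoly.

Lemma mpoly_noetherian (R : comNzRingType) n :
  noetherian R -> noetherian {mpoly R[n]}.
Proof.
move=> noethR; elim: n => [|n IHn].
  apply: (noetherian_surj (f := @mpolyC 0 R)) => // f.
  by exists f@_0%MM; rewrite [RHS]nvar0_mpolyC.
pose phi : {rmorphism {poly {mpoly R[n]}} -> {mpoly R[n.+1]}} :=
  horner_eval 'X_ord_max \o map_poly (@mwiden n R).
apply: (noetherian_surj (f := phi)) => [|f]; first exact: hilbert_basis.
pose im := [set g | exists q, phi q = g].
have imD g h : im g -> im h -> im (g + h).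
  by move=> [q <-] [r <-]; exists (q + r); rewrite rmorphD.
have imM g h : im g -> im h -> im (g * h).
  by move=> [q <-] [r <-]; exists (q * r); rewrite rmorphM.
have im1 : im 1 by exists 1; rewrite rmorph1.
have imC c : im c%:MP.
  exists (c%:MP)%:P.
  by rewrite /phi /= map_polyC /horner_eval hornerC /= mwidenC.
have imX i : im 'X_i.
  have [j ->|->] := unliftP ord_max i.
    exists ('X_j)%:P; rewrite /phi /= map_polyC /horner_eval hornerC /=.
    rewrite mwidenX mnmwiden1; congr 'X_[U_(_)].
    by apply: val_inj; rewrite /= /bump leqNgt ltn_ord.
  by exists 'X; rewrite /phi /= map_polyX /horner_eval hornerX.
suff: im f by [].
rewrite (mpolyE f); apply: (big_ind im) => [| |m _].
- by exists 0; rewrite rmorph0.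
- exact: imD.
rewrite -mul_mpolyC mpolyXE_id; apply: (imM) => //.
apply: (big_ind im); [exact: im1|exact: imM|move=> i _].
elim: (m i) => [|k IHk]; rewrite ?expr0 // exprS; exact: imM.
Qed.

(** * The kernels of substitutions by ratios *)

Lemma homog_scale (R : comNzRingType) n d (c : R) (v : 'I_n -> R)
    (f : {mpoly R[n]}) :
  f \is d.-homog -> f.@[fun i => c * v i] = c ^+ d * f.@[v].
Proof.
move=> /dhomogP homf; rewrite !mevalE big_distrr [LHS]big_seq [RHS]big_seq.
apply: eq_bigr => m /homf <- /=; rewrite mulrCA; congr (_ * _).
by under eq_bigr do rewrite exprMn; rewrite big_split /= prodrXr -mdegE.
Qed.

Section Substitutions.
Variables (R : comNzRingType) (n : nat).
Implicit Types (p q M : set R).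
Local Notation B := {mpoly R[n.+1]}.

Section Chain.
Variables (a : 'I_n.+1 -> R) (p : set R).
Hypotheses (prp : is_prime p) (npa : ~ p (a ord0)).

(* Up to the unit [a ord0] this is the substitution ['X_j := (a j / a ord0) *:
   'X_0]; with the other variables also multiplied by [a ord0], no denominator
   is needed. *)
Definition subst_ratio (j : 'I_n.+1) : {rmorphism B -> B} :=
  mmap (@mpolyC n.+1 R)
    (fun i => if i == j then (a j)%:MP * 'X_ord0 else (a ord0)%:MP * 'X_i).

Lemma subst_ratioC j c : subst_ratio j c%:MP = c%:MP.
Proof. by rewrite /subst_ratio /= mmapC. Qed.

Lemma subst_ratioX j i : subst_ratio j 'X_i =
  if i == j then (a j)%:MP * 'X_ord0 else (a ord0)%:MP * 'X_i.
Proof. by rewrite /subst_ratio /= mmapX mmap1U. Qed.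

Lemma subst_ratio0 j : subst_ratio j 'X_ord0 = (a ord0)%:MP * 'X_ord0.
Proof. by rewrite subst_ratioX; case: eqP => [<-|]. Qed.

(** Commutation makes the nested preimages below stable under every [subst_ratio i], hence
    increasing. *)
Lemma subst_ratio_comm i j f :
  subst_ratio i (subst_ratio j f) = subst_ratio j (subst_ratio i f).
Proof.
pose phi : {rmorphism B -> B} := subst_ratio i \o subst_ratio j.
pose psi : {rmorphism B -> B} := subst_ratio j \o subst_ratio i.
apply: (mpoly_rmorph_ext (phi := phi) (psi := psi)) => [c|k] /=.
  by rewrite !subst_ratioC.
have [->//|neij] := eqVneq i j.
have [->|nekj] := eqVneq k j.
  rewrite !subst_ratioX eqxx eq_sym (negPf neij) !rmorphM /= !subst_ratioC.
  by rewrite subst_ratio0 subst_ratioX eqxx !mulrA [_%:MP * _%:MP]mulrC.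
rewrite !subst_ratioX (negPf nekj); case: eqP => [->|/eqP neki].
  rewrite !rmorphM /= !subst_ratioC subst_ratio0 subst_ratioX eqxx !mulrA.
  by rewrite [_%:MP * _%:MP]mulrC.
by rewrite !rmorphM /= !subst_ratioC !subst_ratioX (negPf nekj) (negPf neki).
Qed.

(* [ratio_prime j] is the kernel of
   [R['X_0, .., 'X_n] -> (R / p)_(a ord0)['X_0, 'X_(j+1), .., 'X_n]]
   sending ['X_i] to [(a i / a ord0) *: 'X_0] for [i <= j]. *)
Fixpoint ratio_prime (j : nat) : set B :=
  if j is j'.+1 then subst_ratio (inord j) @^-1` ratio_prime j'
  else extension p.

Lemma ratio_prime_prime j : is_prime (ratio_prime j).
Proof.
by elim: j => [|j IHj] /=; [apply: extension_prime|apply: prime_preimage].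
Qed.

Lemma ratio_prime_subst i j f :
  ratio_prime j f -> ratio_prime j (subst_ratio i f).
Proof.
elim: j f => [|j IHj] f /=; last first.
  by rewrite /preimage /= subst_ratio_comm; apply: IHj.
move: f; apply: (@extension_sub _ _ p (subst_ratio i @^-1` extension p)).
  by apply: ideal_preimage; apply: extension_ideal; apply: prime_ideal.
move=> c pc; rewrite /preimage /= subst_ratioC.
by apply/extensionC => //; apply: prime_ideal.
Qed.

Lemma ratio_primeC j c : ratio_prime j c%:MP -> p c.
Proof.
elim: j => [|j IHj] /=; first by move/extensionC; apply; apply: prime_ideal.
by rewrite /preimage /= subst_ratioC.
Qed.

(** The substitutions up to [j] only multiply ['X_i] and ['X_ord0] by [a ord0], which cancels modulo
    [p]. With [b = a ord0], [c = a i] and [i = j.+1] this separates consecutive kernels. *)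
Lemma ratio_prime_linear j (i : 'I_n.+1) b c : (j < i)%N ->
  ratio_prime j (b%:MP * 'X_i - c%:MP * 'X_ord0) -> p b.
Proof.
elim: j b c => [|j IHj] b c ltji /=.
  move/(_ U_(i)%MM); rewrite mcoeffB !mcoeffCM !mcoeffXU eqxx mulr1.
  by case: eqP ltji => [<-//|_ _]; rewrite mulr0 subr0.
rewrite /preimage /= rmorphB !rmorphM /= !subst_ratioC subst_ratio0.
rewrite subst_ratioX ifN; last first.
  have ltjn : (j.+1 < n.+1)%N by apply: ltn_trans ltji (ltn_ord i).
  by apply: contraTneq ltji => ->; rewrite inordK ?ltnn.
rewrite !mulrA -!rmorphM /= => /(IHj _ _ (ltnW ltji)).
by move=> /(primeM prp)[].
Qed.

Lemma ratio_prime_proper j : (j < n)%N -> ratio_prime j `<` ratio_prime j.+1.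
Proof.
move=> ltjn; split; first by move=> f; apply: ratio_prime_subst.
have valj : (inord j.+1 : 'I_n.+1) = j.+1 :> nat by apply: inordK.
move=> leq; apply: npa.
apply: (@ratio_prime_linear j (inord j.+1) _ (a (inord j.+1))).
  by rewrite valj.
apply: leq; rewrite /= /preimage /= rmorphB !rmorphM /= !subst_ratioC.
rewrite subst_ratio0 subst_ratioX eqxx !mulrA [_%:MP * _%:MP]mulrC subrr.
by apply: ideal0; apply: prime_ideal; apply: ratio_prime_prime.
Qed.

(** Restriction to the line through [b]: one ring morphism carrying the values at [b] of all
    homogeneous components. *)
Definition line_subst (b : 'I_n.+1 -> R) : {rmorphism B -> {poly R}} :=
  mmap (polyC : {rmorphism R -> {poly R}}) (fun i => (b i)%:P * 'X).

Lemma coef_line_subst b f e : (line_subst b f)`_e = (pihomog mdeg e f).@[b].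
Proof.
rewrite pihomogE raddf_sum /line_subst /= /mmap coef_sum [RHS]big_mkcond.
apply: eq_bigr => m _ /=.
rewrite coefCM /mmap1.
under eq_bigr do rewrite exprMn -rmorphXn.
rewrite big_split /= -rmorph_prod coefCM prodrXr -mdegE coefXn eq_sym.
case: eqP => _; last by rewrite !mulr0.
by rewrite mulr1 mevalZ mevalX.
Qed.

(** Multiples of [a] satisfy [a_0 X_j = a_j X_0], so on them each substitution is scaling by
    [a ord0]. *)
Lemma line_subst_ratio b j f (k : nat) :
  (forall i, b i = a ord0 ^+ k * a i) ->
  line_subst b (subst_ratio j f) =
  line_subst (fun i => a ord0 ^+ k.+1 * a i) f.
Proof.
move=> bE.
pose phi : {rmorphism B -> {poly R}} := line_subst b \o subst_ratio j.
apply: (mpoly_rmorph_ext (phi := phi)) => [c|i] /=.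
  by rewrite subst_ratioC /line_subst /= !mmapC.
rewrite subst_ratioX /line_subst /=.
case: eqP => [->|_]; rewrite rmorphM /= mmapC !mmapX !mmap1U bE /=.
  by rewrite mulrA -polyCM [a j * _]mulrC -exprSr.
by rewrite mulrA -polyCM mulrA -exprS.
Qed.

(** The iterated substitutions evaluate [f] on the line through a power of [a ord0] times [a];
    homogeneity extracts powers of [a ord0], which are outside [p]. *)
Lemma ratio_prime_homog j f : ratio_prime j f ->
  forall e, p (pihomog mdeg e f).@[a].
Proof.
move=> qf e.
suff [k /(_ e)] : exists k, forall e,
    p (line_subst (fun i => a ord0 ^+ k * a i) f)`_e.
  rewrite coef_line_subst (@homog_scale _ _ e); last exact: pihomogP.
  by case/(primeM prp) => // /(primeX prp)/(primeX prp).
elim: j f qf => [|j IHj] f /=; last first.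
  move=> /IHj[k pk]; exists k.+1 => d; have := pk d.
  by rewrite (@line_subst_ratio _ _ _ k).
move=> pf; exists 0%N => {}e; rewrite coef_line_subst.
rewrite mevalE; apply: ideal_sum => [|m _]; first exact: prime_ideal.
apply: ideal_mulr; first exact: prime_ideal.
rewrite pihomogE raddf_sum; apply: ideal_sum => [|k _] /=.
  exact: prime_ideal.
by rewrite mcoeffZ; apply: ideal_mulr; first exact: prime_ideal.
Qed.

End Chain.

Lemma ratio_prime_chain (a : 'I_n.+1 -> R) (p M : set R) :
    is_prime p -> is_prime M -> ~ p (a ord0) -> M (a ord0) ->
    (forall d (f : B), f \is d.-homog -> p f.@[a] -> extension M f) ->
  chain_below n.+1 (extension p : set B) (extension M).
Proof.
move=> prp prM npa Ma indep.
have idM := extension_ideal n.+1 (prime_ideal prM).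
have leqM : ratio_prime a p n `<=` extension M.
  move=> f qf; rewrite (@pihomog_partitionE _ _ mdeg _ f (leqnn _)).
  apply: (ideal_sum _ idM) => d _; apply: (indep d); first exact: pihomogP.
  exact: ratio_prime_homog qf d.
pose F i := if (i <= n)%N then ratio_prime a p i else extension M.
have := @chain_below_fun _ F n.+1 (extension M); apply.
- by move=> i _; rewrite /F; case: ifP => _;
    [apply: ratio_prime_prime|apply: extension_prime].
- move=> i; rewrite ltnS leq_eqVlt => /predU1P[->|ltin]; rewrite /F; last first.
    by rewrite ltin ltnW //; apply: ratio_prime_proper.
  (* The top inclusion is strict: the constant [a ord0] is in [M], but constants of the kernel are
     in [p]. *)
  rewrite leqnn ltnn; split=> // leMq; apply: npa.
  apply: (@ratio_primeC _ _ prp n).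
  by apply: leMq; apply/extensionC => //; apply: prime_ideal.
- by rewrite /F ltnn.
Qed.

End Substitutions.

(** * Analytic independence and heights *)

Section AnalyticIndependence.
Variable R : comNzRingType.
Implicit Types (M p Q : set R).

(* Analytic independence modulo [p], without the conditions on the [a i]. *)
Definition forms_independent M p n (a : 'I_n -> R) : Prop :=
  forall d (f : {mpoly R[n]}), f \is d.-homog -> p f.@[a] -> extension M f.

(** The form ['X_i] has the coefficient [1], which is outside [M]. *)
Lemma forms_independent_neq M p n (a : 'I_n -> R) i :
  is_prime M -> forms_independent M p a -> ~ p (a i).
Proof.
move=> prM indep pa; apply: (prime1 prM).
have := indep 1%N 'X_i; rewrite dhomogX /= mdeg1 mevalXU.
move=> /(_ isT pa U_(i)%MM).
by rewrite mcoeffXU eqxx; apply.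
Qed.

Hypothesis noethR : noetherian R.

Lemma forms_independent_prime M n (a : 'I_n -> R) : is_prime M ->
    forms_independent M [set 0] a ->
  exists2 p, is_prime p & forms_independent M p a.
Proof.
move=> prM indep.
have prE := extension_prime n prM; have idE := prime_ideal prE.
have id0 : is_ideal [set 0 : R].
  by split=> // [x y -> ->|b x ->]; rewrite /= ?addr0 ?mulr0.
pose S := [set x | exists d (f : {mpoly R[n]}),
  [/\ f \is d.-homog, ~ extension M f & f.@[a] = x]].
have [|||g [p [prp _ pS _ _]]] := @prime_avoiding _ noethR [set 0] S id0.
- by exists 0%N, 1; split; [exact: dhomog1|exact: prime1|exact: meval1].
- move=> _ _ [d [f [homf nMf <-]]] [e [h [homh nMh <-]]].
  exists (d + e)%N, (f * h); split; [exact: dhomogM|exact: primeMn|].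
  by rewrite mevalM.
- by move=> x [d [f [homf nMf <-]]] /(indep _ _ homf).
exists p => // d f homf pf; apply: contrapT => nMf.
by apply: pS pf; exists d, f.
Qed.

Lemma forms_independent_le M p (s : seq R) n (a : 'I_n -> R) :
    is_prime M -> is_prime p -> forms_independent M p a ->
    (forall i, M (a i)) -> (forall y, y \in s -> M y) ->
    minimal_over (p `|` [set y | y \in s]) M ->
  (n <= size s)%N.
Proof.
case: n a => // n a prM prp indep aM sM minM.
have [idM idp] := (prime_ideal prM, prime_ideal prp).
rewrite -(size_map (@mpolyC n.+1 R) s).
apply: (@krull_height _ (mpoly_noetherian noethR)
  (extension p) (extension M)).
- exact: extension_prime.
- exact: extension_prime.
- by move=> _ /mapP[y ys ->]; apply/extensionC => //; apply: sM.
- exact: extension_minimal.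
- exact: ratio_prime_chain (forms_independent_neq prM indep) (aM _) indep.
Qed.

Lemma chain_below_extension n k Q M : is_prime Q -> chain_below k Q M ->
  chain_below k (extension Q : set {mpoly R[n]}) (extension M).
Proof.
elim: k Q => [|k IHk] Q prQ /=; first by move=> leQM f Qf m; apply: leQM.
case=> Q' [prQ' ltQ chQ']; exists (extension Q'); split.
- exact: extension_prime.
- by apply: extension_proper => //; apply: prime_ideal.
- exact: IHk.
Qed.

Lemma ideal_congrM (A : comPzRingType) (I : set A) x y x' y' : is_ideal I ->
  I (x - y) -> I (x' - y') -> I (x * x' - y * y').
Proof.
move=> idI Ixy Ixy'.
have -> : x * x' - y * y' = x' * (x - y) + y * (x' - y').
  by rewrite !mulrBr addrA ![x' * _]mulrC subrK.
by apply: idealD => //; apply: ideal_mull.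
Qed.

(* For a prime [P] between [extension p] and [extension M], the congruences
   ['X_0 * y i = 'X_i * y 0] mod [P] turn a form [f] with [f.@[y]] in [p] into
   [y 0 ^+ d * f] in [P].  So if [f] is not in [extension M] then [y 0], and
   with it every [y i], lies in [P]; hence these [n] congruences already make
   [extension M] minimal, contradicting Krull's height theorem. *)
Lemma parameters_independent M p (s : seq R) n :
    is_prime M -> is_prime p -> size s = n.+1 -> (forall y, y \in s -> M y) ->
    minimal_over (p `|` [set y | y \in s]) M -> chain_below n.+1 p M ->
  forms_independent M p (fun i : 'I_n.+1 => s`_i).
Proof.
move=> prM prp sz_s sM minM chp d f homf pf; apply: contrapT => nMf.
have [idM idp] := (prime_ideal prM, prime_ideal prp).
pose y (i : 'I_n.+1) := s`_i.
have ys i : y i \in s by rewrite mem_nth // sz_s.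
pose z i : {mpoly R[n.+1]} := 'X_ord0 * (y i)%:MP - 'X_i * (y ord0)%:MP.
(* [z ord0] vanishes and is left out, so [n] generators face a chain of length [n.+1]. *)
pose t := [seq z (lift ord0 i) | i <- enum 'I_n].
have prEM := extension_prime n.+1 prM.
suff : (n.+1 <= size t)%N by rewrite size_map size_enum_ord ltnn.
apply: (@krull_height _ (mpoly_noetherian noethR)
  (extension p) (extension M)) => //.
- exact: extension_prime.
- move=> _ /mapP[i _ ->].
  have idEM := prime_ideal prEM.
  by apply: (idealB idEM); apply: (ideal_mull _ idEM);
    apply/extensionC => //; apply: sM.
- move=> P prP leP lePM; have idP := prime_ideal prP.
  have Pz i : P (z i).
    have [j ->|->] := unliftP ord0 i; last by rewrite /z subrr; apply: ideal0.
    by apply: leP; right; apply: map_f; rewrite mem_enum.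
  have Pyf : P ((y ord0)%:MP ^+ d * f).
    have : P ('X_ord0 ^+ d * (f.@[y])%:MP).
      apply: ideal_mull => //; apply: leP; left; exact/extensionC.
    apply: (@ideal_subr _ P) => //.
    rewrite -opprB; apply: idealN => //.
    rewrite [in X in _ - X](mpolyE f) mevalE rmorph_sum !big_distrr -sumrB.
    rewrite big_seq; apply: ideal_sum => // m /(dhomog_mf homf) mdegm /=.
    rewrite -mul_mpolyC rmorphM !(mulrCA _ (f@_m)%:MP) -mulrBr.
    (* The exponent [d] is split along the exponents of [m], so the congruence follows factor by
       factor from [Pz]. *)
    apply: ideal_mull => //; rewrite -mdegm /= mdegE -!prodrXr (mpolyXE_id _ m).
    rewrite rmorph_prod -!big_split /=.
    apply: (big_ind2 (fun u v => P (u - v))) => [|u1 v1 u2 v2 P1 P2|i _].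
    + by rewrite subrr; apply: ideal0.
    + exact: ideal_congrM.
    rewrite rmorphXn -!exprMn; elim: (m i) => [|k IHk].
      by rewrite !expr0 subrr; apply: ideal0.
    rewrite !exprS; apply: ideal_congrM => //.
    by rewrite [X in _ - X]mulrC; apply: Pz.
  have Py0 : P (y ord0)%:MP.
    by case/(primeM prP): Pyf => [/(primeX prP)//|/lePM/nMf].
  have nX0 : ~ P 'X_ord0.
    by move=> /lePM/(_ U_(ord0)%MM); rewrite mcoeffXU eqxx; apply: prime1.
  have Py i : P (y i)%:MP.
    have : P ('X_ord0 * (y i)%:MP).
      by apply: (ideal_subr idP (Pz i)); apply: ideal_mull.
    by case/(primeM prP).
  pose c := @mpolyC n.+1 R : {rmorphism R -> {mpoly R[n.+1]}}.
  apply: extension_sub => //; apply: (minM (c @^-1` P)).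
  - exact: prime_preimage.
  - move=> x [px|/(nthP 0)[i lti <-]]; last first.
      by rewrite sz_s in lti; apply: (Py (Ordinal lti)).
    by apply: leP; left; apply/extensionC.
  - by move=> x /lePM/extensionC; apply.
- exact: chain_below_extension.
Qed.

End AnalyticIndependence.

(** * The ideal [0 : J^oo] and primes of its quotient *)

Section AnnInf.
Variables (A : comPzRingType) (J : ideal A).
Hypothesis noethA : noetherian A.
Local Notation I := (ann_inf J : set A).

Lemma pow_setX c m : ideal_set J c -> pow_set J m (c ^+ m).
Proof.
move=> Jc; elim: m => [//|m IHm].
exists 1%N, (fun=> c), (fun=> c ^+ m); split=> //.
by rewrite big_ord1 exprS.
Qed.

Lemma ann_inf_sub p c : is_prime p -> ideal_set J c -> ~ p c -> I `<=` p.
Proof.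
move=> prp Jc npc r [m _ rJ].
have : p (r * c ^+ m).
  by rewrite rJ; [apply: ideal0; apply: prime_ideal|apply: pow_setX].
by case/(primeM prp) => // /(primeX prp).
Qed.

(** One exponent [m] serves all the finitely many generators of [J]; then [J^(m+1)] kills [x]. *)
Lemma ann_inf_colon x : (forall c, ideal_set J c -> I (c * x)) -> I x.
Proof.
move=> JxI; have [s [sJ Js]] := noetherian_gen noethA (idealP J).
have [m sm] : exists m, forall c, c \in s -> ann_set (pow_set J m) (c * x).
  elim: s sJ {Js} => [|c s IHs] sJ; first by exists 0%N.
  have [|m sm] := IHs; first by move=> y ys; apply: sJ; rewrite inE ys orbT.
  have [k _ ck] := JxI c (sJ c (mem_head _ _)).
  exists (maxn k m) => y ys z zJ; move: ys; rewrite inE => /orP[/eqP->|ys].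
    by apply: ck; apply: pow_sub zJ; rewrite leq_maxl.
  by apply: (sm y ys); apply: pow_sub zJ; rewrite leq_maxr.
exists m.+1 => // _ [k [a [b [ab ->]]]]; rewrite big_distrr big1 // => i _ /=.
have [Ja Jb] := ab i; rewrite mulrCA mulrA.
pose K := [set c | c * x * b i = 0].
have idK : is_ideal K.
  split; rewrite /K /=; first by rewrite !mul0r.
    by move=> u v uK vK; rewrite !mulrDl uK vK addr0.
  by move=> r u uK; rewrite -!mulrA [u * _]mulrA uK mulr0.
by apply: (Js K idK _ (a i) Ja) => c cs; apply: (sm c cs).
Qed.

(** [p] is an associated prime of [I] localized at [P], with witness [g]. If it contained [J], some
    [w] outside [P] would give [J w g] inside [I], so [w * g] in [I] by [ann_inf_colon], against the
    choice of [g]. *)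
Lemma ann_inf_prime P : is_prime P -> I `<=` P ->
  exists p, [/\ is_prime p, I `<=` p, p `<=` P & ~ ideal_set J `<=` p].
Proof.
move=> prP leIP; have idI := idealP (ann_inf J).
have [|||g [p [prp leIp pP Ig pI]]] :=
    prime_avoiding noethA (S := ~` P) idI.
- exact: prime1.
- by move=> x y nPx nPy; apply: primeMn.
- by move=> x nPx /leIP.
exists p; split=> // [x px|leJp]; first by apply: contrapT => /pP.
have [s [sJ Js]] := noetherian_gen noethA (idealP J).
have [w nPw sw] : exists2 w, ~ P w & forall c, c \in s -> I (c * (w * g)).
  elim: s sJ {Js} => [|c s IHs] sJ; first by exists 1 => //; apply: prime1.
  have [|w nPw sw] := IHs; first by move=> y ys; apply: sJ; rewrite inE ys orbT.
  have [v nPv cv] := pI c (leJp c (sJ c (mem_head _ _))).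
  exists (v * w); first exact: primeMn.
  move=> y; rewrite inE => /orP[/eqP->|ys].
    by rewrite -mulrA (mulrCA v) (mulrCA c); apply: ideal_mull.
  by rewrite -mulrA (mulrCA y); apply: ideal_mull => //; apply: sw.
apply: (Ig w nPw); apply: ann_inf_colon => c Jc.
exact: (Js _ (colon_ideal (w * g) idI)).
Qed.

End AnnInf.

(** * Primes of a quotient ring and primes over the ideal *)

Section QuotientPrimes.
Variables (A : comPzRingType) (I : ideal A).
Local Notation Q := (quotient_ring I).

Definition quotient_proj (x : A) : Q := (\pi_Q x)%qT.

Lemma quotient_proj_zmod_morphism : zmod_morphism quotient_proj.
Proof.
move=> x y; apply: (addIr (quotient_proj y)); rewrite subrK.
by rewrite /quotient_proj quotient_piD subrK.
Qed.

Lemma quotient_proj_monoid_morphism : monoid_morphism quotient_proj.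
Proof. by split=> // x y; rewrite /quotient_proj -quotient_piM. Qed.

HB.instance Definition _ :=
  GRing.isZmodMorphism.Build A Q quotient_proj quotient_proj_zmod_morphism.
HB.instance Definition _ :=
  GRing.isMonoidMorphism.Build A Q quotient_proj quotient_proj_monoid_morphism.


Lemma quotient_proj_eq x y :
  quotient_proj x = quotient_proj y -> ideal_set I (x - y).
Proof. by move/eqP/quotient_eqP. Qed.

Lemma quotient_proj_surj q : exists x, quotient_proj x = q.
Proof. by exists (repr q); apply: reprK. Qed.

Definition quotient_image (P : set A) : set Q := [set q | P (repr q)].

Lemma quotient_imageE P x : is_ideal P -> ideal_set I `<=` P ->
  quotient_image P (quotient_proj x) <-> P x.
Proof.
move=> idP leIP.
have /quotient_proj_eq/leIP Px :
    quotient_proj (repr (quotient_proj x)) = quotient_proj x.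
  exact: reprK.
split=> Px'; last exact: (ideal_subr idP Px).
by rewrite -[x](subKr (repr (quotient_proj x))); apply: (idealB idP).
Qed.

Lemma quotient_image_prime P : is_prime P -> ideal_set I `<=` P ->
  is_prime (quotient_image P).
Proof.
move=> prP leIP; have idP := prime_ideal prP.
have E x := quotient_imageE x idP leIP.
split; first split.
- by rewrite -(rmorph0 (@quotient_proj)); apply/E; apply: ideal0.
- move=> q r; have [x <-] := quotient_proj_surj q.
  have [y <-] := quotient_proj_surj r; move=> /E Px /E Py.
  by rewrite -rmorphD; apply/E; apply: idealD.
- move=> q r; have [x <-] := quotient_proj_surj q.
  have [y <-] := quotient_proj_surj r; move=> /E Py.
  by rewrite -rmorphM; apply/E; apply: ideal_mull.
- by rewrite -(rmorph1 (@quotient_proj)) => /E/(prime1 prP).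
- move=> q r; have [x <-] := quotient_proj_surj q.
  have [y <-] := quotient_proj_surj r.
  by rewrite -rmorphM => /E/(primeM prP)[] Pxy; [left|right]; apply/E.
Qed.

Lemma quotient_prime_chain n :
  (exists P : 'I_n.+1 -> set Q, prime_chain P) <->
  (exists F : nat -> set A, [/\ ideal_set I `<=` F 0%N,
     forall i, (i <= n)%N -> is_prime (F i) &
     forall i, (i < n)%N -> F i `<` F i.+1]).
Proof.
split=> [[P [prP ltP]]|[F [leI prF ltF]]].
  exists (fun i => quotient_proj @^-1` P (inord i)).
  split=> [x Ix|i lein|i ltin].
  - have -> : P (inord 0) = P ord0.
      by congr P; apply: val_inj; rewrite /= inordK.
    rewrite /preimage /=; have -> : quotient_proj x = 0.
      rewrite -(rmorph0 (@quotient_proj)); apply/eqP/quotient_eqP.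
      by rewrite subr0.
    by apply: ideal0; apply: prime_ideal.
  - exact: prime_preimage.
  - have [|leP nleP] := ltP (inord i) (inord i.+1).
      by rewrite !inordK // ltnS ltnW.
    split=> [x|leQ]; first exact: leP.
    by apply: nleP => q; have [x <-] := quotient_proj_surj q; apply: leQ.
have monoF i j : (i <= j)%N -> (j <= n)%N -> F i `<=` F j.
  move=> /subnK <-; elim: (j - i)%N => [_|k IHk]; first exact: subset_refl.
  rewrite addSn => lekn.
  by apply: (subset_trans (IHk (ltnW lekn))); case: (ltF _ lekn).
have leIF i : (i <= n)%N -> ideal_set I `<=` F i.
  by move=> lein; apply: subset_trans leI _; apply: monoF.
exists (fun i => quotient_image (F i)); split=> [i|i j ltij].
  by apply: quotient_image_prime; [apply: prF|apply: leIF]; rewrite -ltnS.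
have lejn : (j <= n)%N by rewrite -ltnS.
have [lein ltin] : (i <= n)%N /\ (i < n)%N.
  by split; [apply: leq_trans (ltnW ltij) _|apply: leq_trans lejn].
have [_ nle] := ltF i ltin.
have Ei x := quotient_imageE x (prime_ideal (prF i lein)) (leIF i lein).
have Ej x := quotient_imageE x (prime_ideal (prF j lejn)) (leIF j lejn).
split=> [q|le]; first exact: monoF (ltnW ltij) lejn _.
by apply: nle => x /(monoF _ _ ltij lejn) /Ej /le /Ei.
Qed.

End QuotientPrimes.

Lemma bounded_nat_max (S : set nat) (b m : nat) :
    S m -> (forall n, S n -> (n <= b)%N) ->
  exists2 d, S d & forall n, S n -> (n <= d)%N.
Proof.
move=> Sm Sb.
have exS : exists n, `[< S n >] by exists m; apply/asboolP.
have [|d /asboolP Sd dmax] := @ex_maxnP (fun n => `[< S n >]) b exS.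
  by move=> n /asboolP/Sb.
by exists d => // n Sn; apply: dmax; apply/asboolP.
Qed.

(** * Local rings *)

Lemma maximal_prime (A : comPzRingType) (M : set A) :
  is_maximal M -> is_prime M.
Proof.
case=> idM properM maxM; split=> // [M1|u v Muv].
  by move/eqP: properM; apply; apply: ideal_is_full.
have [|] := maxM _ (adjoin_ideal u idM) (@sub_adjoin _ M u) => adjE.
  by left; rewrite -adjE; apply: adjoin_gen.
have [m [r [Mm E1]]] : adjoin M u 1 by rewrite adjE.
right; rewrite -[v]mul1r E1 mulrDl; apply: idealD => //.
  exact: ideal_mulr.
by rewrite -mulrA; apply: ideal_mull.
Qed.

Section LocalRing.
Variables (R : comUnitRingType) (M : set R) (J : ideal R).
Hypotheses (noethR : noetherian R) (localR : local_with M).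

Lemma local_prime : is_prime M.
Proof. by apply: maximal_prime; case: localR. Qed.

Lemma proper_sub_local I : is_ideal I -> ~ I 1 -> I `<=` M.
Proof.
move=> idI nI1; have [N maxN leIN] := sub_maximal noethR idI nI1.
by case: localR => _ /(_ N maxN) <-.
Qed.

Lemma local_nonunit x : x \isn't a GRing.unit <-> M x.
Proof.
split=> [nUx|Mx]; last first.
  apply/negP => Ux; apply: (prime1 local_prime).
  rewrite -(mulVr Ux); apply: ideal_mull => //.
  exact: prime_ideal local_prime.
have id0 : is_ideal [set 0 : R].
  by split=> // [u v -> ->|b u ->]; rewrite /= ?addr0 ?mulr0.
apply: (proper_sub_local (adjoin_ideal x id0)); last exact: adjoin_gen.
case=> y [r [-> /esym]]; rewrite add0r => rx1; move/negP: nUx; apply.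
by apply/unitrPr; exists r; rewrite mulrC.
Qed.

Lemma analytic_lengths_forms n (a : 'I_n -> R) :
    (forall i, ideal_set J (a i)) -> (forall i, M (a i)) ->
    forms_independent M [set 0] a ->
  analytic_lengths M J n.
Proof.
move=> Ja Ma indep; exists a; split=> //; split=> [i|d f homf fa m].
  split; last by apply/local_nonunit.
  by apply/eqP; apply: forms_independent_neq local_prime indep.
exact: (indep d f homf fa m).
Qed.

(** Every prime lies in [M], so these are the lengths of the chains of primes of [R / I]. *)
Definition chain_lengths (I : set R) : set nat :=
  [set n | exists Q, [/\ is_prime Q, I `<=` Q & chain_below n Q M]].

(** The restriction to [0 < d] covers the unit ideal: the zero ring has no chain, but dimension
    [0]. *)
Lemma krull_dim_quotient (I : ideal R) d :
    (forall n, chain_lengths I n -> (n <= d)%N) ->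
    (0 < d -> chain_lengths I d)%N ->
  krull_dim (quotient_ring I) d.
Proof.
have E n : (exists P : 'I_n.+1 -> set (quotient_ring I), prime_chain P) <->
    chain_lengths I n.
  rewrite quotient_prime_chain; split.
    move=> [F [leI prF ltF]]; exists (F 0%N); split=> //; first exact: prF.
    apply: chain_below_fun => //; have prFn := prF n (leqnn n).
    by apply: proper_sub_local; [apply: prime_ideal|apply: prime1].
  move=> [Q [prQ leIQ /(fun_chain_below prQ)[F [F0 prF ltF]]]].
  by exists F; rewrite F0.
move=> Ld dL; split=> [n /= /E/Ld //|b bub].
case: d dL {Ld} => [|d] dL; first exact: leq0n.
by apply: bub; apply/E/dL.
Qed.

Lemma analytic_lengths_le d s :
    (forall n, chain_lengths (ann_inf J) n -> (n <= d)%N) ->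
  analytic_lengths M J s -> (s <= d)%N.
Proof.
move=> Ld [a [Ja [na indep]]]; case: s a Ja na indep => // s a Ja na indep.
have prM := local_prime.
have [|p prp indp] := @forms_independent_prime _ noethR M _ a prM.
  by move=> e f homf fa m; apply: indep homf fa m.
have leIp : (ann_inf J : set R) `<=` p.
  exact: ann_inf_sub prp (Ja ord0) (forms_independent_neq prM indp).
have [n Q prQ lepQ chQ|t [le_t tM minM]] :=
    @system_of_parameters _ M p d noethR prM (prime_ideal prp).
  by apply: Ld; exists Q; split=> //; apply: subset_trans lepQ.
apply: leq_trans le_t.
apply: (forms_independent_le noethR prM prp indp _ tM minM) => i.
by have [_ /local_nonunit] := na i.
Qed.

(** A polynomial in no variables is a constant, equal to its value. *)
Lemma analytic_lengths0 : analytic_lengths M J 0.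
Proof.
apply: (@analytic_lengths_forms 0 (fun=> 0)) => [[]//|[]//|d f _].
rewrite (nvar0_mpolyC f) mevalC => ->; rewrite mpolyC0.
by apply: (ideal0 (extension_ideal _ _)); apply: prime_ideal local_prime.
Qed.

Lemma chain_analytic_length n : chain_lengths (ann_inf J) n ->
    (forall k, chain_lengths (ann_inf J) k -> (k <= n)%N) ->
  analytic_lengths M J n.
Proof.
have prM := local_prime; have idM := prime_ideal prM.
case: n => [_ _|n [Q [prQ leIQ chQ]] Ln].
  exact: analytic_lengths0.
have [p [prp leIp lepQ /exists_in_setD[c Jc npc]]] :=
  ann_inf_prime noethR prQ leIQ.
have chp : chain_below n.+1 p M.
  case: chQ => Q' [prQ' [leQ nleQ] chQ']; exists Q'; split=> //; split.
    exact: subset_trans leQ.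
  by move=> leQ'p; apply: nleQ; apply: subset_trans lepQ.
have [k Q' prQ' lepQ' chQ'|t [le_t tM minM]] :=
    @system_of_parameters _ M p n.+1 noethR prM (prime_ideal prp).
  by apply: Ln; exists Q'; split=> //; apply: subset_trans lepQ'.
(* At most [n.+1] by the choice of [t], at least [n.+1] by Krull's height theorem for the chain
   above [p]. *)
have sz_t : size t = n.+1.
  by apply/eqP; rewrite eqn_leq le_t (krull_height noethR prp prM tM minM chp).
have indy := parameters_independent noethR prM prp sz_t tM minM chp.
apply: (@analytic_lengths_forms _ (fun i : 'I_n.+1 => c * t`_i)).
- by move=> i; apply: ideal_mulr => //; apply: idealP.
- move=> i; apply: ideal_mull => //; apply: tM.
  by rewrite mem_nth ?sz_t ?ltn_ord.
(* The factor [c] moves the parameters into [J] and scales the value of [f] by [c ^+ d]; as [c] is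
   outside [p], a zero value puts the value at [t] in [p]. *)
move=> d f homf; rewrite (homog_scale _ _ homf) => fy0.
apply: (indy d f homf); have : p (c ^+ d * f.@[fun i : 'I_n.+1 => t`_i]).
  by rewrite fy0; apply: ideal0; apply: prime_ideal.
by case/(primeM prp) => // /(primeX prp).
Qed.

(** The number of generators of [M] is a bound, by Krull's height theorem. *)
Lemma chain_lengths_bounded :
  exists b, forall I n, chain_lengths I n -> (n <= b)%N.
Proof.
have prM := local_prime.
have [s [sM Ms]] := noetherian_gen noethR (prime_ideal prM).
exists (size s) => I n [Q [prQ _ chQ]].
apply: (krull_height noethR prQ prM sM _ chQ) => Q' prQ' leQ' _.
apply: Ms; first exact: prime_ideal.
by move=> x xs; apply: leQ'; right.
Qed.

End LocalRing.

Theorem corollary1p10 (R : comUnitRingType) (M : set R) (J : ideal R)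
    (noethR : noetherian R) (localR : local_with M) :
  exists d : nat,
    krull_dim (quotient_ring (ann_inf J)) d /\ is_max (analytic_lengths M J) d.
Proof.
have [b Lb] := chain_lengths_bounded noethR localR.
have [[n Ln]|L0] := EM (exists n, chain_lengths M (ann_inf J) n).
  have [d Ld dmax] := bounded_nat_max Ln (Lb (ann_inf J)).
  exists d; split.
    exact: (krull_dim_quotient noethR localR dmax (fun=> Ld)).
  split; first exact: (chain_analytic_length noethR localR).
  by move=> s; apply: (analytic_lengths_le noethR localR).
(* No prime contains [ann_inf J]: the quotient is the zero ring, of dimension [0], and only the
   empty family is independent. *)
exists 0%N; split.
  by apply: (krull_dim_quotient noethR localR) => // n Ln; case: L0; exists n.
split; last first.
  move=> s; apply: (analytic_lengths_le noethR localR) => // n Ln.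
  by case: L0; exists n.
exact: analytic_lengths0.
Qed.
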